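(* For every path-connected topological group $G$ and every integer $n\ge 2$, $$\operatorname{TC}_n(G)=\operatorname{cat}(G^{n-1}).$$
   Context: All numerical invariants are normalized and may take the value $\infty$ (when no finite number as required exists). For a space $Z$, $\operatorname{cat}(Z)$ is the (normalized) Lusternik-Schnirelmann category: the least $k$ such that $Z$ has an open cover $A_0,\ldots,A_k$ with each inclusion $A_i\hookrightarrow Z$ null-homotopic. $G^{m}$ is the $m$-fold cartesian power. The Schwarz genus of a map $p:E\to B$ is the least $k$ such that there is an open cover $U_0,\ldots,U_k$ of $B$ and, for each $i$, a continuous map $s_i:U_i\to E$ with $p s_i$ homotopic to the inclusion $U_i\hookrightarrow B$. For a fibration this is equivalent to requiring honest local sections $ps_i=$ inclusion. Let $J_n$ be the wedge of $n$ copies of $[0,1]$, each with base point $0$, and let $1_i$ denote the point $1$ in the $i$-th copy. $\operatorname{TC}_n(X)$, the $n$-th topological complexity of a path-connected space $X$, is the Schwarz genus of the fibration $e_n:X^{J_n}\to X^n$, $e_n(\gamma)=(\gamma(1_1),\ldots,\gamma(1_n))$, where $X^{J_n}$ is the space of continuous maps $J_n\to X$ with the compact-open topology. *)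

(* Defs.v *)
From HB Require Import structures.
From mathcomp Require Import all_boot all_order all_algebra.
From mathcomp Require Import all_classical all_reals.
From mathcomp Require Import topology ereal normedtype wedge_sigT continuous_path.

Set Implicit Arguments.
Unset Strict Implicit.
Unset Printing Implicit Defensive.

Import Order.TTheory GRing.Theory Num.Theory.
Import numFieldNormedType.Exports.

Local Open Scope classical_set_scope.
Local Open Scope ring_scope.

HB.mixin Record isTopologicalGroup G & Topological G & Group G := {
  mulg_continuous : continuous (fun xy : G * G => (xy.1 * xy.2)%g) ;
  invg_continuous : continuous (fun x : G => (x^-1)%g)
}.

#[short(type="topologicalGroupType")]
HB.structure Definition TopologicalGroup :=
  {G of Topological G & Group G & isTopologicalGroup G}.

Section unit_interval.
Variable R : realType.

Definition unit_itv : Type := set_type (`[0, 1]%classic : set R).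

HB.instance Definition _ :=
  Topological.copy unit_itv (set_type (`[0, 1]%classic : set R)).

Let unit_itv0_subproof : (0 : R) \in (`[0, 1]%classic : set R).
Proof. by rewrite inE /= in_itv /= lexx ler01. Qed.

Let unit_itv1_subproof : (1 : R) \in (`[0, 1]%classic : set R).
Proof. by rewrite inE /= in_itv /= lexx ler01. Qed.

Definition unit_itv0 : unit_itv := exist _ 0 unit_itv0_subproof.
Definition unit_itv1 : unit_itv := exist _ 1 unit_itv1_subproof.

Let unit_itv_neq : unit_itv0 != unit_itv1.
Proof. by apply/eqP => -[] /esym/eqP; rewrite oner_eq0. Qed.

HB.instance Definition _ := isBiPointed.Build unit_itv unit_itv_neq.

End unit_interval.

Definition path_connected (R : realType) (X : topologicalType) : Prop :=
  forall x y : X, $|{path (unit_itv R) from x to y in X}|.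

Definition homotopic (R : realType) (X Y : topologicalType) (f g : X -> Y) :
    Prop :=
  exists H : X * unit_itv R -> Y,
    [/\ continuous H, forall x, H (x, zero) = f x
      & forall x, H (x, one) = g x].

Definition null_homotopic (R : realType) (X Y : topologicalType) (f : X -> Y) :
    Prop :=
  exists y : Y, homotopic R f (cst y).

Definition open_cover (X : topologicalType) (k : nat)
    (U : 'I_k.+1 -> set X) : Prop :=
  (forall i, open (U i)) /\ \bigcup_i U i = [set: X].

(* The infimum of a nonempty set of naturals is attained, and the infimum of
   the empty set is +oo: see [least_eq] and [least_infty]. *)
Definition least (R : realType) (P : set nat) : \bar R :=
  ereal_inf [set k%:R%:E | k in P].

Lemma least_eq (R : realType) (P : set nat) (k : nat) :
  P k -> (forall j, P j -> (k <= j)%N) -> least R P = k%:R%:E.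
Proof.
move=> Pk kmin; apply/eqP; rewrite eq_le; apply/andP; split.
  by apply: ereal_inf_lbound; exists k.
by apply: le_ereal_inf_tmp => _ [j Pj <-]; rewrite lee_fin ler_nat kmin.
Qed.

Lemma least_infty (R : realType) : least R set0 = +oo%E.
Proof. by rewrite /least image_set0 ereal_inf0. Qed.

Definition LScat (R : realType) (Z : topologicalType) : \bar R :=
  least R [set k | exists A : 'I_k.+1 -> set Z, open_cover A /\
    forall i, null_homotopic R (set_val : A i -> Z)].

Definition schwarz_genus (R : realType) (E B : topologicalType) (p : E -> B) :
    \bar R :=
  least R [set k | exists U : 'I_k.+1 -> set B, open_cover U /\
    forall i, exists s : U i -> E,
      continuous s /\ homotopic R (p \o s) (set_val : U i -> B)].

Definition map_space (X Y : topologicalType) : Type := continuousType X Y.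

HB.instance Definition _ (X Y : topologicalType) :=
  Topological.copy (map_space X Y)
    (@initial_topology (continuousType X Y) {compact-open, X -> Y}
       (fun f => f : X -> Y)).

Definition cartesian_power (X : topologicalType) (m : nat) : topologicalType :=
  {ptws 'I_m -> X}.

Definition J_base (R : realType) (n : nat) : 'I_n -> unit_itv R :=
  fun=> zero.

Definition J (R : realType) (n : nat) : topologicalType :=
  wedge (@J_base R n).

Definition J_one (R : realType) (n : nat) (i : 'I_n) : J R n :=
  @wedge_lift 'I_n (fun=> unit_itv R) (@J_base R n) i one.

Definition e_ (R : realType) (n : nat) (X : topologicalType) :
    map_space (J R n) X -> cartesian_power X n :=
  fun gamma i => (gamma : continuousType (J R n) X) (J_one R i).

Definition TC (R : realType) (n : nat) (X : topologicalType) : \bar R :=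
  schwarz_genus R (@e_ R n X).

(* Main.v *)
Require Import Defs.
From HB Require Import structures.
From mathcomp Require Import all_boot all_order all_algebra.
From mathcomp Require Import all_classical all_reals topology.
From mathcomp Require Import normedtype wedge_sigT continuous_path.

(** The translation [(x_0, .., x_m) |-> (x_0^-1 x_1, .., x_0^-1 x_m)] retracts
    [G^m.+1] onto [G^m], with section [(y_j) |-> (1, y_1, .., y_m)].  The legs
    of [J_n] share their base point, so translating a path in [G^{J_n}] joins
    its translated endpoints to [1]: a local section of [e_n] over [U]
    contracts the trace of [U] on [G^m].  Conversely, left multiplication by
    [x_0] turns a contraction of [A] in [G^m] into a local section over the
    preimage of [A].  The group law replaces reversal and concatenation of
    homotopies: [y F^-1 a] runs from [y a^-1 a = y] to [a] when [F] runs from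
    [a] to [y], and [L^-1 w P^-1 a] runs from [a] to [1] when [L] runs from [1]
    to [w] and [P] from [w] to [a]. *)

Import numFieldNormedType.Exports.

Local Open Scope classical_set_scope.

(** * Continuity and compactness in general spaces *)

Lemma continuous_compose {X Y Z : topologicalType} (g : Y -> Z) (f : X -> Y) :
  continuous g -> continuous f -> continuous (fun x => g (f x)).
Proof.
move=> cg cf x; apply: (@continuous_comp _ _ _ f g); first exact: cf.
exact: cg.
Qed.

Lemma continuous_pair (X Y Z : topologicalType) (f : X -> Y) (g : X -> Z) :
  continuous f -> continuous g -> continuous (fun x => (f x, g x)).
Proof. by move=> cf cg x; apply: cvg_pair; [exact: cf|exact: cg]. Qed.

Lemma continuous_fst (X Y : topologicalType) : continuous (@fst X Y).
Proof. by move=> x; exact: cvg_fst. Qed.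

Lemma continuous_snd (X Y : topologicalType) : continuous (@snd X Y).
Proof. by move=> x; exact: cvg_snd. Qed.

Lemma set_val_continuous (X : topologicalType) (A : set X) :
  continuous (set_val : A -> X).
Proof. exact: initial_continuous. Qed.

Lemma hausdorff_subtype (X : topologicalType) (A : set X) :
  hausdorff_space X -> hausdorff_space A.
Proof.
move=> hX x y xy; apply: val_inj; apply: hX => U V Ux Vy.
have vc := @set_val_continuous X A.
by have [z [Uz Vz]] := xy _ _ (vc _ _ Ux) (vc _ _ Vy); exists (val z).
Qed.

(** The subtype is the continuous image of [A] under an extension of its identity to [X]. Such an
    extension needs a default value in [A], so the empty case is split off. *)
Lemma compact_subtype (X : topologicalType) (A : set X) :
  compact A -> compact [set: A].
Proof.
move=> cA; have [[y]|A0] := pselect (inhabited A); last first.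
  rewrite (_ : [set: A] = set0); first exact: compact0.
  by rewrite -subset0 => x _; exact: A0.
have cid := proj2 (@subspace_valL_continuousP' X A _ y id) (fun x => cvg_id).
have := continuous_compact cid cA.
congr compact; rewrite -subTset => z _; exists (val z); first exact: set_valP.
by have /(congr1 (@^~ z)) := @valLK _ _ y A id.
Qed.

Lemma compact_locally_compact (X : topologicalType) :
  compact [set: X] -> locally_compact [set: X].
Proof.
move=> cX x _; rewrite withinET; exists setT; first exact: filterT.
by split; [exact: cX|exact: closedT].
Qed.

Lemma compact_hausdorff_regular (X : topologicalType) :
  compact [set: X] -> hausdorff_space X -> regular_space X.
Proof.
by move=> cX hX x; apply: (compact_regular _ cX) => //; exact: filterT.
Qed.

(** * The interval, the wedge [J] and evaluation on it *)

Lemma unit_itv_hausdorff (R : realType) : hausdorff_space (unit_itv R).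
Proof. exact/hausdorff_subtype/Rhausdorff. Qed.

Lemma unit_itv_compact (R : realType) : compact [set: unit_itv R].
Proof. exact/compact_subtype/segment_compact. Qed.

(** [J_leg i one] is [J_one R i], so following the legs up to time [one] ends at the value of
    [e_]. *)
Definition J_leg {R : realType} {n : nat} (i : 'I_n) (t : unit_itv R) : J R n :=
  @wedge_lift 'I_n (fun=> unit_itv R) (@J_base R n) i t.

Lemma J_leg_continuous {R : realType} {n : nat} (i : 'I_n) :
  continuous (@J_leg R n i).
Proof.
exact: (@wedge_lift_continuous 'I_n (fun=> unit_itv R) (@J_base R n) i).
Qed.

Lemma J_leg0 {R : realType} {n : nat} (i j : 'I_n) :
  J_leg i zero = J_leg j zero :> J R n.
Proof. exact: (@wedge_liftE _ _ (@J_base R n) j zero i zero). Qed.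

(** Evaluation is jointly continuous for the compact-open topology when the source is locally
    compact and regular; a finite wedge of intervals is compact and Hausdorff, which gives both. *)
Lemma J_eval_continuous (R : realType) (n : nat) (X : topologicalType) :
  continuous (fun gx : map_space (J R n) X * J R n =>
    (gx.1 : continuousType (J R n) X) gx.2).
Proof.
have cJ : compact [set: J R n].
  apply: wedge_compact => [|i]; first exact: finite_finset.
  exact: unit_itv_compact.
rewrite (_ : (fun _ => _) = @eval (J R n) X); last by apply/funext => -[].
apply: (@eval_continuous (J R n) X); first exact: compact_locally_compact.
apply: compact_hausdorff_regular => //.
by apply: wedge_hausdorff => i; exact: unit_itv_hausdorff.
Qed.

(** * Powers, preimages and pulled-back covers *)

Lemma continuous_ptws (X Y : topologicalType) (m : nat)
    (f : X -> cartesian_power Y m) :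
  (forall i, continuous (fun x => f x i)) -> continuous f.
Proof.
move=> cf x; apply/cvg_sup => i U [_ [[C oC <-] Cfx] /filterS]; apply.
by apply: (cf i x C); exact: open_nbhs_nbhs.
Qed.

Lemma coord_continuous (Y : topologicalType) (m : nat) (i : 'I_m) :
  continuous (fun f : cartesian_power Y m => f i).
Proof. exact: (@proj_continuous _ (fun=> Y) i). Qed.

Lemma continuous_coord {X Y : topologicalType} {m : nat}
    (f : X -> cartesian_power Y m) (i : 'I_m) :
  continuous f -> continuous (fun x => f x i).
Proof.
apply: (continuous_compose (fun y : cartesian_power Y m => y i)).
exact: coord_continuous.
Qed.

Section preimage_restriction.
Context {X Y : topologicalType} (f : X -> Y) (A : set Y).

Definition restrict_preimage (x : f @^-1` A) : A :=
  exist _ (f (val x)) (mem_set (set_valP x)).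

Lemma restrict_preimage_continuous :
  continuous f -> continuous restrict_preimage.
Proof.
move=> cf; apply: continuous_comp_initial => x.
apply: (@continuous_comp _ _ _ (set_val : f @^-1` A -> X) f).
  exact: set_val_continuous.
exact: cf.
Qed.

End preimage_restriction.

Lemma open_cover_preimage (X Y : topologicalType) (f : X -> Y) (k : nat)
    (A : 'I_k.+1 -> set Y) :
  continuous f -> open_cover A -> open_cover (fun i => f @^-1` A i).
Proof.
move=> /continuousP cf [oA covA]; split=> [i|]; first exact/cf/oA.
by rewrite -preimage_bigcup covA preimage_setT.
Qed.

(** * Translation and padding in powers of a topological group *)

Section topological_group.
Context {G : topologicalGroupType}.
Implicit Types (X : topologicalType) (m : nat).

Lemma continuous_mulg X (f g : X -> G) :
  continuous f -> continuous g -> continuous (fun x => f x * g x)%g.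
Proof.
move=> cf cg x.
apply: (@continuous_comp _ _ _ (fun x => (f x, g x)) (fun xy => xy.1 * xy.2)%g).
  by apply: cvg_pair; [exact: cf|exact: cg].
exact: mulg_continuous.
Qed.

Lemma continuous_invg X (f : X -> G) :
  continuous f -> continuous (fun x => (f x)^-1)%g.
Proof.
move=> cf x; apply: (@continuous_comp _ _ _ f (fun y : G => y^-1%g)).
  exact: cf.
exact: invg_continuous.
Qed.

Definition pad {m} (y : cartesian_power G m) : cartesian_power G m.+1 :=
  fun i => if unlift ord0 i is Some j then y j else 1%g.

Definition translate {m} (x : cartesian_power G m.+1) : cartesian_power G m :=
  fun j => ((x ord0)^-1 * x (lift ord0 j))%g.

Lemma pad_continuous m : continuous (@pad m).
Proof.
apply: continuous_ptws => i; rewrite /pad.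
by case: unliftP => [j _|_]; [exact: coord_continuous|exact: cst_continuous].
Qed.

Lemma translate_continuous m : continuous (@translate m).
Proof.
apply: continuous_ptws => j.
apply: continuous_mulg; last exact: coord_continuous.
exact/continuous_invg/coord_continuous.
Qed.

Lemma pad0 m (y : cartesian_power G m) : pad y ord0 = 1%g.
Proof. by rewrite /pad unlift_none. Qed.

Lemma pad_lift m (y : cartesian_power G m) j : pad y (lift ord0 j) = y j.
Proof. by rewrite /pad liftK. Qed.

Lemma padK m : cancel (@pad m) (@translate m).
Proof.
by move=> y; apply/funext => j; rewrite /translate pad0 pad_lift invg1 mul1g.
Qed.

(** Used to recognise the end of a homotopy carried from the smaller power to the larger one by left
    multiplication. *)
Lemma translateK m (x : cartesian_power G m.+1) i :
  (x ord0 * pad (translate x) i)%g = x i.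
Proof.
case: (unliftP ord0 i) => [j|] ->; last by rewrite pad0 mulg1.
by rewrite pad_lift mulgA mulgV mul1g.
Qed.

(** * From local sections to contractions *)

Lemma null_homotopic_pad_preimage (R : realType) m
    (U : set (cartesian_power G m.+1)) (s : U -> map_space (J R m.+1) G) :
  continuous s -> homotopic R (@e_ R m.+1 G \o s) (set_val : U -> _) ->
  null_homotopic R (set_val : (@pad m @^-1` U) -> cartesian_power G m).
Proof.
move=> cs [H [cH H0 H1]].
set B := (pad @^-1` U); pose r : B -> U := restrict_preimage pad U.
have cr : continuous r by exact/restrict_preimage_continuous/pad_continuous.
have crp : continuous (fun bt : B * unit_itv R => r bt.1).
  by apply: (continuous_compose r) => //; exact: continuous_fst.
pose path (bt : B * unit_itv R) := translate (H (r bt.1, bt.2)).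
have cpath : continuous path.
  apply: (continuous_compose translate); first exact: translate_continuous.
  apply: (continuous_compose H) => //; apply: continuous_pair => //.
  exact: continuous_snd.
(* All legs are followed at the same time [bt.2], so at time [zero] the coordinates agree and the
   translate is trivial. *)
pose leg (bt : B * unit_itv R) : cartesian_power G m := translate (fun i =>
  (s (r bt.1) : continuousType (J R m.+1) G) (J_leg i bt.2)).
have cleg : continuous leg.
  apply: (continuous_compose translate); first exact: translate_continuous.
  apply: continuous_ptws => i.
  apply: (continuous_compose _ (fun bt : B * unit_itv R => (s (r bt.1), _))
    (J_eval_continuous R m.+1 G)).
  apply: continuous_pair; first exact: (continuous_compose s).
  apply: (continuous_compose (J_leg i)); first exact: J_leg_continuous.
  exact: continuous_snd.
(* This is [L^-1 w P^-1 a] with [L] = [leg], [w] its value at time [one], [P] = [path] and [a] the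
   point itself. *)
exists (fun=> 1%g), (fun bt j =>
  (leg bt j)^-1 * leg (bt.1, one) j * (path bt j)^-1 * set_val bt.1 j)%g.
split.
- have cB : continuous (fun bt : B * unit_itv R => set_val bt.1).
    apply: (continuous_compose (@set_val _ B)).
      exact: set_val_continuous.
    exact: continuous_fst.
  have cw : continuous (fun bt : B * unit_itv R => leg (bt.1, one)).
    apply: (continuous_compose leg) => //; apply: continuous_pair.
      exact: continuous_fst.
    exact: cst_continuous.
  apply: continuous_ptws => j.
  apply: continuous_mulg; last exact: continuous_coord _ _ cB.
  apply: continuous_mulg; last exact/continuous_invg/continuous_coord/cpath.
  apply: continuous_mulg; last exact: continuous_coord _ _ cw.
  exact/continuous_invg/continuous_coord/cleg.
- move=> b; apply/funext => j /=.
  have -> : leg (b, zero) j = 1%g.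
    by rewrite /leg /translate /= (J_leg0 _ ord0) mulVg.
  (* [H] starts at the endpoints of the section, so [path] starts where [leg] ends. *)
  have -> : path (b, zero) j = leg (b, one) j by rewrite /path /= H0.
  by rewrite invg1 mul1g mulgV mul1g.
- move=> b; apply/funext => j /=.
  have -> : path (b, one) = set_val b by rewrite /path H1; exact: padK.
  by rewrite mulVg mul1g mulVg.
Qed.

(** * From contractions to local sections *)

Lemma section_translate_preimage (R : realType) m
    (A : set (cartesian_power G m)) :
  path_connected R G ->
  null_homotopic R (set_val : A -> cartesian_power G m) ->
  exists s : (@translate m @^-1` A) -> map_space (J R m.+1) G,
    continuous s /\ homotopic R (@e_ R m.+1 G \o s)
                       (set_val : (@translate m @^-1` A) -> _).
Proof.
move=> pcG [y [H [cH H0 H1]]].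
set V := (translate @^-1` A); pose r : V -> A := restrict_preimage translate A.
have cr : continuous r.
  exact/restrict_preimage_continuous/translate_continuous.
have cV : continuous (fun xt : V * unit_itv R => set_val xt.1).
  apply: (continuous_compose (@set_val _ V)); first exact: set_val_continuous.
  exact: continuous_fst.
have crV : continuous (fun xt : V * unit_itv R => r xt.1).
  by apply: (continuous_compose r) => //; exact: continuous_fst.
have cq : continuous (fun xt : V * unit_itv R => translate (set_val xt.1)).
  by apply: (continuous_compose translate) => //; exact: translate_continuous.
(* [H^-1 a] runs from [1] to [y^-1 a], so every leg starts at [x_0], as gluing requires; leg [ord0]
   stays there. *)
pose k (i : 'I_m.+1) (x : V) (t : unit_itv R) : G := (set_val x ord0 *
  pad (fun j => (H (r x, t) j)^-1 * translate (set_val x) j) i)%g.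
have ck i : continuous (uncurry (k i)).
  have -> : uncurry (k i) = fun xt => k i xt.1 xt.2 by apply/funext => -[].
  apply: continuous_mulg; first exact: continuous_coord _ _ cV.
  apply: (continuous_coord (fun xt => pad _)).
  apply: (continuous_compose pad); first exact: pad_continuous.
  apply: continuous_ptws => j.
  apply: continuous_mulg; last exact: continuous_coord _ _ cq.
  apply: continuous_invg.
  apply: (continuous_coord (fun xt => H (r xt.1, xt.2))).
  apply: (continuous_compose H) => //; apply: continuous_pair => //.
  exact: continuous_snd.
have k0 i x : k i x zero = set_val x ord0.
  rewrite /k (_ : (fun _ => _) = fun=> 1%g).
    by rewrite /pad; case: unlift; rewrite mulg1.
  by apply/funext => j; rewrite H0 mulVg.
have kE i j x : k i x zero = k j x zero by rewrite !k0.
pose w (x : V) : J R m.+1 -> G := wedge_fun (fun i => k i x).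
have cw : continuous (uncurry w).
  (* Gluing keeps continuity jointly in [x] and the point of [J]: there are finitely many legs, and
     base points are closed. *)
  apply: wedge_fun_joint_continuous => //; first exact: finite_finset.
  move=> i; apply: accessible_closed_set1.
  exact/hausdorff_accessible/unit_itv_hausdorff.
(* Currying yields both that each [w x] is a map on [J] and that it varies continuously in the
   compact-open topology. *)
have [cw' cwx] := continuous_curry cw.
pose s (x : V) : map_space (J R m.+1) G :=
  HB.pack (w x) (isContinuous.Build _ _ (w x) (cwx x)).
exists s; split; first by apply: continuous_comp_initial.
have es x i : e_ (s x) i = k i x one by rewrite /e_ /= /w wedge_lift_funE.
(* The legs end at [x_0 y^-1 a] instead of [x_0 a]. Path-connectedness supplies paths from [y_j^-1]
   to [1] that correct this by a homotopy. *)
have p j : {path unit_itv R from (y j)^-1%g to 1%g in G}.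
  by have /unsquash := pcG (y j)^-1%g 1%g.
exists (fun xt i => set_val xt.1 ord0 *
  pad (fun j => p j xt.2 * translate (set_val xt.1) j) i)%g; split.
- apply: continuous_ptws => i.
  apply: continuous_mulg; first exact: continuous_coord _ _ cV.
  apply: (continuous_coord (fun xt => pad _)).
  apply: (continuous_compose pad); first exact: pad_continuous.
  apply: continuous_ptws => j.
  apply: continuous_mulg; last exact: continuous_coord _ _ cq.
  apply: (continuous_compose (p j)); first exact: cts_fun.
  exact: continuous_snd.
- move=> x; apply/funext => i; rewrite [RHS]es /k; congr (_ * pad _ _)%g.
  by apply/funext => j; rewrite path_zero H1.
- move=> x; apply/funext => i; rewrite -[RHS]translateK; congr (_ * pad _ _)%g.
  by apply/funext => j; rewrite path_one mul1g.
Qed.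

End topological_group.

Theorem theorem3p5 (R : realType) (G : topologicalGroupType) (n : nat)
    (G_path_connected : path_connected R G) (n_ge2 : (2 <= n)%N) :
  TC R n G = LScat R (cartesian_power G n.-1).
Proof.
case: n n_ge2 => // m _; rewrite /TC /schwarz_genus /LScat /=.
(* Pulling covers back along [pad] or [translate] preserves the number of sets, so both infima range
   over the same [k]. *)
congr (least R _); apply/seteqP; split => k /=.
  move=> [U [covU sU]]; exists (fun i => @pad G m @^-1` U i).
  split=> [|i]; first exact/open_cover_preimage/covU/pad_continuous.
  by have [s [cs hs]] := sU i; exact: null_homotopic_pad_preimage cs hs.
move=> [A [covA hA]]; exists (fun i => @translate G m @^-1` A i).
split=> [|i]; first exact/open_cover_preimage/covA/translate_continuous.
exact: section_translate_preimage.
Qed.
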